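(* Let $q\equiv 3 \pmod 4$ be a prime power such that $q \geq 7$. Let $u \in \mathbb{F}_{q^2}\setminus \mathbb{F}_q$ and let $N(u)$ be the $\mathbb{F}_q$-neighborhood of $u$ in the Peisert graph $P_{q^2}^*$. Then $N(u) \cup \{u\}$ forms a maximal clique of size $\frac{q+1}{2}$ in $P_{q^2}^*$.
   Context: Let $p\equiv 3\pmod 4$ be a prime and $Q=p^s$ with $s$ even. The Peisert graph $P^*_Q$ of order $Q$ is the graph with vertex set the finite field $\mathbb{F}_Q$ in which two vertices are adjacent if and only if their difference belongs to the set $S=\{g^j : j\equiv 0,1 \pmod 4\}$, where $g$ is a (fixed) primitive root of $\mathbb{F}_Q$ (the structure of the graph does not depend on the choice of $g$). Here $Q=q^2$. The $\mathbb{F}_q$-neighborhood of $u\in\mathbb{F}_{q^2}\setminus\mathbb{F}_q$ in $P^*_{q^2}$ is $N(u)=\{x\in\mathbb{F}_q : u-x\in S\}$, the set of vertices in the subfield $\mathbb{F}_q$ adjacent to $u$. A clique is a set of vertices any two distinct elements of which are adjacent; a maximal clique is a clique that cannot be extended to a larger clique by adding a new vertex. *)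

(* Defs.v *)
From mathcomp Require Import all_boot all_algebra.

Set Implicit Arguments.
Unset Strict Implicit.
Unset Printing Implicit Defensive.

Import GRing.Theory.
Local Open Scope ring_scope.

Section Cliques.
Variables (T : finType) (e : rel T).

Definition clique (A : {set T}) : bool :=
  [forall x in A, forall y in A, (x != y) ==> e x y].

Definition maximal_clique (A : {set T}) : bool :=
  clique A && [forall v, (v \notin A) ==> ~~ clique (v |: A)].

End Cliques.

Section Peisert.
Variables (F : finFieldType) (g : F).

Definition is_primitive_root : bool := (#|F|.-1).-primitive_root g.

(* Exponents below #|F|.-1 suffice when g is a primitive root and 4 divides
   #|F|.-1; peisert_setP removes the bound. *)
Definition peisert_set : {set F} :=
  [set g ^+ (j : nat) | j : 'I_(#|F|.-1) & ((j %% 4)%N == 0%N) || ((j %% 4)%N == 1%N)].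

Definition peisert_adj : rel F := fun x y => x - y \in peisert_set.

(* The set of neighbours of u lying in K. *)
Definition peisert_nbhd (K : {set F}) (u : F) : {set F} :=
  [set x in K | peisert_adj u x].

Lemma peisert_setP (x : F) :
  is_primitive_root -> (4 %| #|F|.-1)%N ->
  x \in peisert_set <->
  exists2 j : nat, ((j %% 4)%N == 0%N) || ((j %% 4)%N == 1%N) & x = g ^+ j.
Proof.
move=> g_prim dvd4; split.
  by case/imsetP=> j; rewrite inE => hj ->; exists (j : nat).
case=> j hj ->; have n_gt0 : (0 < #|F|.-1)%N := prim_order_gt0 g_prim.
apply/imsetP; exists (Ordinal (ltn_pmod j n_gt0)).
  by rewrite inE /= !modn_dvdm.
by rewrite /= (prim_expr_mod g_prim).
Qed.

End Peisert.

(* Main.v *)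
(* Write q + 1 = 4k, m = (q - 1)k, i = g^m, and let bar be x |-> x^q. The set S
   consists of the y with y^m equal to 1 or i. For x in F_q one has
   (u - x)^m = ((x - bar u)/(x - u))^k, so with A = X - bar u and B = X - u the
   polynomial P_u = (A^k - B^k)(A^k - i B^k), of degree less than 2k, vanishes
   on N(u), and M_u = (A^k + B^k)(A^k + i B^k), of degree 2k, vanishes on the
   rest of F_q. Since q = 4k - 1, both bounds on the number of roots are
   attained: |N(u)| = 2k - 1, and N(u) determines P_u and M_u up to scalars.
   A vertex v extending the clique lies outside F_q and satisfies N(v) = N(u).
   Then 2(1 + i) A^k B^k = M_u - P_u is a quadratic form in the k-th powers of
   C = X - bar v and D = X - v; comparing multiplicities at bar u excludes
   k > 2. For k = 2 the same comparison, made also with u and v exchanged,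
   yields (u - v)^m = -i, so that u and v are not adjacent. *)

Require Import Defs.
From mathcomp Require Import all_boot all_algebra all_field.
From mathcomp Require Import ring zify.

Import GRing.Theory.
Local Open Scope ring_scope.

(** Both [p] and [r] are constant multiples of the product of the [X - z] for [z] in [s]. *)
Lemma proportional_of_roots {F : fieldType} {p r : {poly F}} {s : seq F} :
  uniq s -> p != 0 -> r != 0 -> (size p <= (size s).+1)%N ->
  (size r <= (size s).+1)%N -> all (root p) s -> all (root r) s ->
  exists2 c, c != 0 & p = c *: r.
Proof.
move=> s_uniq p0 r0 szp szr rp rr.
have full (t : {poly F}) : t != 0 -> (size t <= (size s).+1)%N ->
    all (root t) s -> t = lead_coef t *: \prod_(z <- s) ('X - z%:P).
  move=> t0 szt rt; apply: all_roots_prod_XsubC; rewrite ?uniq_rootsE //.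
  by apply/eqP; rewrite eqn_leq szt max_poly_roots.
exists (lead_coef p / lead_coef r).
  by rewrite mulf_neq0 ?invr_eq0 ?lead_coef_eq0.
rewrite {1}(full p p0 szp rp) {2}(full r r0 szr rr) scalerA divfK //.
by rewrite lead_coef_eq0.
Qed.

(** * Quadratic forms in the k-th powers of two linear polynomials *)

(* The left-hand side of [quadratic_formE] vanishes to order [k] at [a]. Order
   two forces the quadratic form on the right to be a constant times
   [(C^k - z D^k)^2], where [C = X - c] and [D = X - d], for a scalar [z];
   order three is then impossible. *)
Section QuadraticForm.
Context {F : fieldType} {k : nat} {a b c d w c1 c3 e : F}.
Hypotheses (k_gt1 : (1 < k)%N) (k_neq0 : k%:R != 0 :> F)
  (two_neq0 : 2%:R != 0 :> F) (w_neq0 : w != 0) (c1_neq0 : c1 != 0)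
  (c_neq_d : c != d).
Hypothesis quadratic_formE :
  e *: (('X - a%:P) ^+ k * ('X - b%:P) ^+ k) =
  c1 *: ((('X - c%:P) ^+ k) ^+ 2 + w *: (('X - d%:P) ^+ k) ^+ 2) +
  c3 *: (('X - c%:P) ^+ k * ('X - d%:P) ^+ k).

Let k_gt0 : (0 < k)%N := ltnW k_gt1.
Let hE := (hornerXsubC, hornerD, hornerZ, hornerM, horner_exp).
Let dE := (derivXsubC, derivD, derivZ, derivM, deriv_exp).

Lemma quadratic_form_at_root :
  c1 * (((a - c) ^+ k) ^+ 2 + w * ((a - d) ^+ k) ^+ 2) +
  c3 * ((a - c) ^+ k * (a - d) ^+ k) = 0.
Proof.
have := congr1 (horner^~ a) quadratic_formE.
by rewrite !hE subrr expr0n gtn_eqF // mul0r mulr0 => <-.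
Qed.

(** If just one difference vanished, a single nonzero term would remain in the value at [a]. *)
Lemma quadratic_form_neq : (a - c != 0) && (a - d != 0).
Proof.
have := quadratic_form_at_root.
have [ac0|ac] := eqVneq (a - c) 0; have [ad0|ad] := eqVneq (a - d) 0 => //.
- by move: c_neq_d; rewrite -(subr0_eq ac0) -(subr0_eq ad0) eqxx.
- rewrite ac0 !expr0n gtn_eqF //= expr0n /= add0r mul0r mulr0 addr0 => /eqP.
  rewrite !(mulf_eq0, expf_eq0) (negPf c1_neq0) (negPf w_neq0) (negPf ad).
  by rewrite andbF.
- rewrite ad0 !expr0n gtn_eqF //= expr0n /= !mulr0 !addr0 => /eqP.
  by rewrite !(mulf_eq0, expf_eq0) (negPf c1_neq0) (negPf ac) ?andbF.
Qed.

Lemma quadratic_form_deriv_at_root :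
  2%:R * c1 * ((a - c) ^+ k * (a - c) ^+ k.-1
               + w * ((a - d) ^+ k * (a - d) ^+ k.-1)) +
  c3 * ((a - c) ^+ k.-1 * (a - d) ^+ k + (a - c) ^+ k * (a - d) ^+ k.-1) = 0.
Proof.
have := congr1 (fun p : {poly F} => p^`().[a]) quadratic_formE.
rewrite /= !dE !(hE, hornerMn, hornerC).
rewrite subrr !expr0n !gtn_eqF ?ltn_predRL //= mulr0 mul0rn !mul0r addr0 mulr0.
move=> /esym H; apply: (mulfI k_neq0); rewrite mulr0 -[RHS]H.
by ring.
Qed.

(** The gradient of [c1 (S^2 + w T^2) + c3 S T] vanishes at [S = (a - c)^k], [T = (a - d)^k]: in
    suitable combinations of value and derivative at [a], the nonzero factor [(a - c) - (a - d)]
    splits off. *)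
Lemma quadratic_form_double_root :
  2%:R * c1 * (a - c) ^+ k = - c3 * (a - d) ^+ k /\
  2%:R * c1 * w * (a - d) ^+ k = - c3 * (a - c) ^+ k.
Proof.
have /andP[x0 y0] := quadratic_form_neq.
have := quadratic_form_at_root; have := quadratic_form_deriv_at_root.
have dxy : (a - c) - (a - d) != 0.
  by rewrite (_ : _ - _ = d - c) ?subr_eq0 1?eq_sym //; ring.
have exprk t : t ^+ k = t * t ^+ k.-1 :> F by rewrite -exprS prednK.
move: dxy (expf_neq0 k.-1 x0) (expf_neq0 k.-1 y0); rewrite !exprk.
move: (a - c) (a - d) (_ ^+ _) (_ ^+ _) => x y X Y dxy X0 Y0 H1 H0.
split; apply/eqP; rewrite -subr_eq0; apply/eqP.
  apply: (mulfI (mulf_neq0 X0 dxy)).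
  rewrite mulr0; transitivity (2%:R * 0 - y * 0 : F); last by ring.
  by rewrite -{1}H0 -H1; ring.
apply: (mulfI (mulf_neq0 Y0 dxy)).
rewrite mulr0; transitivity (x * 0 - 2%:R * 0 : F); last by ring.
by rewrite -{1}H1 -H0; ring.
Qed.

(** The gradient equations are linear with a nonzero solution, so their determinant vanishes. *)
Lemma quadratic_form_disc : c3 ^+ 2 = 4%:R * w * c1 ^+ 2.
Proof.
have [E1 E2] := quadratic_form_double_root.
have /andP[_ y0] := quadratic_form_neq.
apply: (mulIf (expf_neq0 k y0)).
transitivity (- c3 * (- c3 * (a - d) ^+ k)); first by ring.
rewrite -E1; transitivity (2%:R * c1 * (- c3 * (a - c) ^+ k)); first by ring.
by rewrite -E2; ring.
Qed.

Lemma quadratic_form_exponent : k = 2%N.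
Proof.
apply/eqP; rewrite eqn_leq k_gt1 andbT leqNgt; apply/negP => k_gt2.
have [E1 _] := quadratic_form_double_root.
have /andP[x0 y0] := quadratic_form_neq.
(* As the discriminant is zero, [4 c1] times the form is [E^2]. For [k > 2], [E] and its derivative
   then vanish at [a], which forces [c3 = 0]. *)
pose E := (2%:R * c1) *: ('X - c%:P) ^+ k + c3 *: ('X - d%:P) ^+ k.
have rE : root E a by rewrite /root !hE E1 mulNr addNr.
have [E' defE] := factor_theorem _ _ rE.
have sqE :
    (4%:R * c1 * e) *: (('X - a%:P) ^+ k * ('X - b%:P) ^+ k) = E ^+ 2.
  rewrite -scalerA quadratic_formE /E -!mul_polyC.
  transitivity (((2%:R * c1)%:P * ('X - c%:P) ^+ k) ^+ 2
     + (4%:R * w * c1 ^+ 2)%:P * (('X - d%:P) ^+ k) ^+ 2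
     + (4%:R * c1 * c3)%:P * (('X - c%:P) ^+ k * ('X - d%:P) ^+ k)).
    by ring.
  by rewrite -quadratic_form_disc; ring.
have E'a0 : E'.[a] = 0.
  move: sqE; rewrite -(subnK k_gt1) defE exprD exprMn => sqE.
  have A2 : ('X - a%:P) ^+ 2 != 0 by rewrite expf_neq0 ?polyXsubC_eq0.
  have : (4%:R * c1 * e) *:
      (('X - a%:P) ^+ (k - 2) * ('X - b%:P) ^+ (k - 2 + 2)) = E' ^+ 2.
    by apply: (mulIf A2); rewrite -sqE -!mul_polyC; ring.
  move/(congr1 (horner^~ a)); rewrite !hE subrr expr0n subn_eq0 leqNgt k_gt2.
  by rewrite mul0r mulr0 => /esym/eqP; rewrite mulf_eq0 orbb => /eqP.
have := congr1 (fun p : {poly F} => p^`().[a]) defE.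
rewrite /= !dE !(hE, hornerMn, hornerC) subrr mulr0 E'a0 mul0r addr0 => dE0.
have {dE0} H1 :
    2%:R * c1 * (a - c) ^+ k.-1 + c3 * (a - d) ^+ k.-1 = 0.
  by apply: (mulfI k_neq0); rewrite mulr0 -dE0; ring.
have exprk t : t ^+ k = t * t ^+ k.-1 :> F by rewrite -exprS prednK.
have dxy : (a - c) - (a - d) != 0.
  by rewrite (_ : _ - _ = d - c) ?subr_eq0 1?eq_sym //; ring.
have c3_0 : c3 = 0.
  apply: (mulIf (mulf_neq0 (expf_neq0 k y0) dxy)); rewrite mul0r.
  transitivity (((a - c) * (a - d)) * 0 - (a - d) * 0 : F); last by ring.
  rewrite -{1}H1 -[X in _ - _ * X](subrr (- c3 * (a - d) ^+ k)) -{1}E1.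
  by rewrite !exprk; ring.
move/eqP: E1; rewrite c3_0 oppr0 mul0r !mulf_eq0 (negPf two_neq0).
by rewrite (negPf c1_neq0) expf_eq0 (negPf x0) andbF.
Qed.
End QuadraticForm.

(** * The quartic character and the size of the neighborhoods *)

Section HalfNeighborhoods.
Context {F : finFieldType} {q k : nat} {ii : F} {K : {set F}}.
Hypotheses (frob : forall x y : F, (x + y) ^+ q = x ^+ q + y ^+ q)
  (k_gt0 : (0 < k)%N) (q_k : q.+1 = (4 * k)%N) (F_card : #|F| = (q ^ 2)%N)
  (ii_sq : ii ^+ 2 = -1) (two_neq0 : 2%:R != 0 :> F)
  (K_fix : forall x, (x \in K) = (x ^+ q == x)) (K_card : #|K| = q).

Let m := (q.-1 * k)%N.
Definition quartic_nbhd (u : F) : {set F} :=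
  [set x in K | ((u - x) ^+ m == 1) || ((u - x) ^+ m == ii)].
Let N := quartic_nbhd.

Lemma q_gt1 : (1 < q)%N.
Proof. by clear - k_gt0 q_k; lia. Qed.

Lemma frobN x : (- x) ^+ q = - x ^+ q :> F.
Proof.
by apply/eqP; rewrite -addr_eq0 -frob addNr expr0n gtn_eqF // ltnW // q_gt1.
Qed.

Lemma frobB x y : (x - y) ^+ q = x ^+ q - y ^+ q :> F.
Proof. by rewrite frob frobN. Qed.

Lemma frobK x : (x ^+ q) ^+ q = x :> F.
Proof. by rewrite -exprM mulnn -F_card expf_card. Qed.

(** This is [y^m = (y^q / y)^k] without division, from [m + k = qk]. *)
Lemma chi_mul (y : F) : y ^+ m * y ^+ k = (y ^+ q) ^+ k.
Proof.
rewrite -exprD -exprM; congr (_ ^+ _); rewrite /m.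
by rewrite -{2}(mul1n k) -mulnDl addn1 prednK // ltnW // q_gt1.
Qed.

Lemma chi_sign (y : F) : y != 0 ->
  [|| y ^+ m == 1, y ^+ m == ii, y ^+ m == -1 | y ^+ m == - ii].
Proof.
move=> y0.
have y4 : (y ^+ m) ^+ 4 = 1.
  apply: (mulfI y0); rewrite mulr1 -exprM -exprS.
  rewrite (_ : (m * 4).+1 = #|F|) ?expf_card // F_card /m -mulnA (mulnC k) -q_k.
  by move: q_gt1 => ?; nia.
have : (y ^+ m - 1) * (y ^+ m - ii) * (y ^+ m + 1) * (y ^+ m + ii) = 0.
  transitivity ((y ^+ m) ^+ 4 - 1 - (ii ^+ 2 + 1) * ((y ^+ m) ^+ 2 - 1)).
    by ring.
  by rewrite y4 ii_sq addNr mul0r !subrr.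
by move/eqP; rewrite !mulf_eq0 !subr_eq0 !addr_eq0 -!orbA.
Qed.

(* On [K], the quartic character [(u - x)^m] equals [((x - u^q) / (x - u))^k],
   so [level_poly u w] cuts out its level set at [w]. *)
Definition level_poly (u w : F) : {poly F} :=
  ('X - (u ^+ q)%:P) ^+ k - w *: ('X - u%:P) ^+ k.

Lemma level_poly_root u w x : x \in K -> u \notin K ->
  root (level_poly u w) x = ((u - x) ^+ m == w).
Proof.
rewrite !K_fix => /eqP xq uq.
have ux0 : (u - x) ^+ k != 0.
  by rewrite expf_neq0 // subr_eq0; apply: contraNneq uq => ->; rewrite xq.
rewrite /root /level_poly hornerD hornerN hornerZ !horner_exp !hornerXsubC.
rewrite -(opprB u x) -(opprB (u ^+ q) x) (exprNn (u - x)) (exprNn (_ - x)).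
(* Since [x^q = x], [u^q - x] is [(u - x)^q], and [(u - x)^k] becomes a common factor. *)
rewrite -{1}xq -frobB -chi_mul.
rewrite (mulrCA w) -mulrBr mulf_eq0 signr_eq0 -mulrBl mulf_eq0 (negPf ux0) orbF.
by rewrite subr_eq0.
Qed.

Lemma level_poly_neq0 u w : u \notin K -> level_poly u w != 0.
Proof.
rewrite K_fix => uq; apply/eqP => /(congr1 (horner^~ u)).
rewrite /level_poly hornerD hornerN hornerZ !horner_exp !hornerXsubC horner0.
rewrite subrr expr0n gtn_eqF // mulr0 subr0 => /eqP; apply/negP.
by rewrite expf_neq0 // subr_eq0 eq_sym.
Qed.

Lemma size_level_poly u w : (size (level_poly u w) <= k.+1)%N.
Proof.
apply: leq_trans (size_polyD _ _) _; rewrite size_polyN geq_max.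
rewrite size_exp_XsubC leqnn (leq_trans (size_scale_leq _ _)) //.
by rewrite size_exp_XsubC.
Qed.

(** For [w = 1] the leading terms cancel; this lowers the degree bound of [in_poly] from [2k] to
    [2k - 1]. *)
Lemma size_level_poly1 u : (size (level_poly u 1%R) <= k)%N.
Proof.
have lc (a : F) : (('X - a%:P) ^+ k)`_k = 1.
  have /monicP := monic_exp k (monicXsubC (R := F) a).
  by rewrite lead_coefE size_exp_XsubC.
apply/leq_sizeP => j; rewrite leq_eqVlt => /predU1P[<-|lt_kj].
  by rewrite coefB scale1r !lc subrr.
by apply/leq_sizeP: lt_kj; apply: size_level_poly.
Qed.

Definition in_poly u := level_poly u 1 * level_poly u ii.
Definition out_poly u := level_poly u (-1) * level_poly u (- ii).

Lemma size_in_poly u : (size (in_poly u) <= (k + k).-1.+1)%N.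
Proof.
apply: leq_trans (size_polyMleq _ _) _.
move: (size_level_poly1 u) (size_level_poly u ii); lia.
Qed.

Lemma size_out_poly u : (size (out_poly u) <= (k + k).+1)%N.
Proof.
apply: leq_trans (size_polyMleq _ _) _.
move: (size_level_poly u (-1)) (size_level_poly u (-ii)); lia.
Qed.

Lemma in_poly_roots u : u \notin K -> all (root (in_poly u)) (enum (N u)).
Proof.
move=> uK; apply/allP => x; rewrite mem_enum inE => /andP[xK xS].
by rewrite rootM !level_poly_root.
Qed.

Lemma out_poly_roots u :
  u \notin K -> all (root (out_poly u)) (enum (K :\: N u)).
Proof.
move=> uK; apply/allP => x; rewrite mem_enum !inE => /andP[+ xK].
rewrite xK /= rootM !level_poly_root // negb_or => /andP[/negPf n1 /negPf n2].
have /chi_sign : u - x != 0 by rewrite subr_eq0; apply: contraNneq uK => ->.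
by rewrite n1 n2.
Qed.

Lemma card_quartic_nbhd u : u \notin K -> #|N u| = (k + k).-1.
Proof.
move=> uK.
have in0 : in_poly u != 0 by rewrite mulf_neq0 // level_poly_neq0.
have out0 : out_poly u != 0 by rewrite mulf_neq0 // level_poly_neq0.
have := max_poly_roots in0 (in_poly_roots u uK) (enum_uniq _).
move/leq_trans/(_ (size_in_poly u)).
have := max_poly_roots out0 (out_poly_roots u uK) (enum_uniq _).
move/leq_trans/(_ (size_out_poly u)).
rewrite -!cardE => lt_out lt_in.
have := cardsID (N u) K; rewrite K_card.
have /setIidPr -> : N u \subset K by apply/subsetP => x; rewrite inE => /andP[].
by move: lt_out lt_in q_k k_gt0; lia.
Qed.

(** * Vertices with equal neighborhoods *)

Hypotheses (k_gt1 : (1 < k)%N) (k_neq0 : k%:R != 0 :> F).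

Lemma ii_neqs : [/\ ii != 0, 1 + ii != 0 & - ii != ii].
Proof.
have n11 : (-1 : F) != 1.
  by rewrite eq_sym -addr_eq0 -[1 + 1]/(2%:R : F).
have ii0 : ii != 0 by rewrite -sqrf_eq0 ii_sq oppr_eq0 oner_eq0.
split=> //; last first.
  by rewrite eq_sym -addr_eq0 -mulr2n -mulr_natr mulf_eq0 negb_or ii0.
apply: contraNneq n11 => /eqP; rewrite addrC addr_eq0 => /eqP i1.
by rewrite -ii_sq i1 sqrrN expr1n.
Qed.

Section Proportional.
Context {u v lam mu : F}.
Hypotheses (in_lam : in_poly u = lam *: in_poly v)
  (out_mu : out_poly u = mu *: out_poly v).

(** With [A], [B] the k-th powers for [u], [in_poly u] is [A^2 - (1 + ii) A B + ii B^2] and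
    [out_poly u] has the opposite middle sign. The sum isolates the squares, the difference in
    [product_identity] the product [A B]. *)
Lemma sum_identity :
  2%:R *: ((('X - (u ^+ q)%:P) ^+ k) ^+ 2 + ii *: (('X - u%:P) ^+ k) ^+ 2) =
  (mu + lam) *:
    ((('X - (v ^+ q)%:P) ^+ k) ^+ 2 + ii *: (('X - v%:P) ^+ k) ^+ 2) +
  ((1 + ii) * (mu - lam)) *: (('X - (v ^+ q)%:P) ^+ k * ('X - v%:P) ^+ k).
Proof.
transitivity (out_poly u + in_poly u).
  by rewrite /in_poly /out_poly /level_poly -!mul_polyC; ring.
by rewrite in_lam out_mu /in_poly /out_poly /level_poly -!mul_polyC; ring.
Qed.

Lemma product_identity :
  (2%:R * (1 + ii)) *: (('X - (u ^+ q)%:P) ^+ k * ('X - u%:P) ^+ k) =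
  (mu - lam) *:
    ((('X - (v ^+ q)%:P) ^+ k) ^+ 2 + ii *: (('X - v%:P) ^+ k) ^+ 2) +
  ((1 + ii) * (mu + lam)) *: (('X - (v ^+ q)%:P) ^+ k * ('X - v%:P) ^+ k).
Proof.
transitivity (out_poly u - in_poly u).
  by rewrite /in_poly /out_poly /level_poly -!mul_polyC; ring.
by rewrite in_lam out_mu /in_poly /out_poly /level_poly -!mul_polyC; ring.
Qed.

(** This supplies the nonzero [c1] of the quadratic form. If [mu = lam], the product identity at
    [u^q] leaves only [v = u^q]. *)
Lemma proportional_neq : u \notin K -> u != v -> lam != 0 -> mu - lam != 0.
Proof.
rewrite K_fix => uq uv lam0; rewrite subr_eq0; apply/eqP => mu_lam.
have [i0 i1 i3] := ii_neqs.
have au : u ^+ q - u != 0 by rewrite subr_eq0.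
have := sum_identity; have := product_identity.
rewrite mu_lam subrr mulr0 !scale0r add0r addr0 => pid sid.
have := congr1 (horner^~ (u ^+ q)) pid.
rewrite !(hornerXsubC, hornerZ, hornerM, horner_exp) subrr expr0n gtn_eqF //.
rewrite mul0r mulr0 => /esym/eqP; rewrite !mulf_eq0 !expf_eq0 k_gt0 /=.
rewrite (negPf i1) -mulr2n -mulr_natr mulf_eq0 (negPf lam0) (negPf two_neq0).
rewrite /= !subr_eq0 => /orP[/eqP|] uv'.
  by case/eqP: uv; rewrite -(frobK u) uv' frobK.
have vu : v ^+ q = u by rewrite -(eqP uv') frobK.
have pw0 : (u ^+ q - u) ^+ k * (u ^+ q - u) ^+ k != 0.
  by rewrite mulf_neq0 ?expf_neq0.
(* Now [v = u^q] swaps the linear factors: the values at [u^q] and [u] give [ii = lam] and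
   [1 = lam ii], hence [ii = -ii]. *)
have := congr1 (horner^~ (u ^+ q)) sid.
rewrite vu -(eqP uv').
rewrite !(hornerXsubC, hornerD, hornerZ, hornerM, horner_exp) subrr.
rewrite expr0n gtn_eqF // !mulr0 add0r addr0 mulrA => /(mulIf pw0) E1.
have pw0' : (u - u ^+ q) ^+ k * (u - u ^+ q) ^+ k != 0.
  by rewrite mulf_neq0 ?expf_neq0 // -opprB oppr_eq0.
have := congr1 (horner^~ u) sid.
rewrite vu -(eqP uv').
rewrite !(hornerXsubC, hornerD, hornerZ, hornerM, horner_exp) subrr.
rewrite expr0n gtn_eqF // !mulr0 add0r addr0 mulrA => /(mulIf pw0') E2.
case/eqP: i3; apply: (mulfI two_neq0); rewrite E1.
have : ii * 2%:R = ii * ((lam + lam) * ii) by rewrite E2.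
rewrite mulrCA -expr2 ii_sq mulrN1 => E3; rewrite -[RHS]opprK -E3; ring.
Qed.

End Proportional.

(* For [k > 2] the two neighborhoods differ; for [k = 2] (that is, [q = 7])
   they may coincide, and only the adjacency of [u] and [v] fails. *)
Lemma eq_quartic_nbhd_not_adj {u v} : u \notin K -> v \notin K -> u != v ->
  N u = N v -> ~~ (((u - v) ^+ m == 1) || ((u - v) ^+ m == ii)).
Proof.
move=> uK vK uv eqN; have [i0 i1 i3] := ii_neqs.
have szN : (k + k).-1 = size (enum (N u)) by rewrite -cardE card_quartic_nbhd.
have szC : (k + k)%N = size (enum (K :\: N u)).
  have := cardsID (N u) K; rewrite K_card -!cardE.
  have /setIidPr -> : N u \subset K.
    by apply/subsetP => x; rewrite inE => /andP[].
  by rewrite card_quartic_nbhd //; move: q_k k_gt0; lia.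
have [lam lam0 in_lam] : exists2 lam, lam != 0 & in_poly u = lam *: in_poly v.
  apply: (proportional_of_roots (enum_uniq (N u))).
  - by rewrite mulf_neq0 // level_poly_neq0.
  - by rewrite mulf_neq0 // level_poly_neq0.
  - by rewrite -szN size_in_poly.
  - by rewrite -szN size_in_poly.
  - exact: in_poly_roots.
  - by rewrite eqN in_poly_roots.
have [mu mu0 out_mu] : exists2 mu, mu != 0 & out_poly u = mu *: out_poly v.
  apply: (proportional_of_roots (enum_uniq (K :\: N u))).
  - by rewrite mulf_neq0 // level_poly_neq0.
  - by rewrite mulf_neq0 // level_poly_neq0.
  - by rewrite -szC size_out_poly.
  - by rewrite -szC size_out_poly.
  - exact: out_poly_roots.
  - by rewrite eqN out_poly_roots.
have c10 := proportional_neq in_lam out_mu uK uv lam0.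
have vqv : v ^+ q != v by rewrite -K_fix.
have uqu : u ^+ q != u by rewrite -K_fix.
have pid := product_identity in_lam out_mu.
(* The form is taken with [a = u^q], [b = u], [c = v^q], [d = v]; only [q = 7] survives. *)
have k2 := quadratic_form_exponent k_gt1 k_neq0 two_neq0 i0 c10 vqv pid.
have [E1 _] := quadratic_form_double_root k_gt1 k_neq0 i0 c10 vqv pid.
have disc := quadratic_form_disc k_gt1 k_neq0 i0 c10 vqv pid.
have in_lam' : in_poly v = lam^-1 *: in_poly u.
  by rewrite in_lam scalerA mulVf ?scale1r.
have out_mu' : out_poly v = mu^-1 *: out_poly u.
  by rewrite out_mu scalerA mulVf ?scale1r.
have c10' : mu^-1 - lam^-1 != 0.
  by rewrite subr_eq0 (inj_eq invr_inj) -subr_eq0.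
have pid' := product_identity in_lam' out_mu'.
have [E1' _] := quadratic_form_double_root k_gt1 k_neq0 i0 c10' uqu pid'.
(* This is [c3 / (2 c1)]. Exchanging [u] and [v] replaces it by [-z], whence the opposite signs in
   [Ez] and [Ez']. *)
pose z := (1 + ii) * (mu + lam) / (2%:R * (mu - lam)).
have den0 : 2%:R * (mu - lam) != 0 by rewrite mulf_neq0.
have z_sq : z ^+ 2 = ii.
  rewrite /z expr_div_n disc; apply: (mulIf (expf_neq0 2 den0)).
  by rewrite divfK ?expf_neq0 //; ring.
have sgn : (-1) ^+ k = 1 :> F by rewrite k2 sqrrN expr1n.
have Ez : (u ^+ q - v ^+ q) ^+ k = - z * (u ^+ q - v) ^+ k.
  by apply: (mulfI den0); rewrite E1 /z; field; rewrite two_neq0 c10.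
have Ez' : (u ^+ q - v ^+ q) ^+ k = z * (v ^+ q - u) ^+ k.
  rewrite -(opprB (v ^+ q)) exprNn sgn mul1r.
  have den0' : 2%:R * (mu^-1 - lam^-1) != 0 by rewrite mulf_neq0.
  apply: (mulfI den0'); rewrite E1' /z; field.
  by rewrite two_neq0 c10 mu0 lam0.
(* Here [q + 1 = 8] and [z^8 = 1], so the Frobenius map, next applied to [Ez'], inverts [z]. *)
have zq : z ^+ q * z = 1.
  rewrite -exprSr q_k k2 -[(4 * 2)%N]/(2 * 4)%N exprM z_sq (exprM _ 2 2).
  by rewrite ii_sq sqrrN expr1n.
have Econj : (v - u ^+ q) ^+ k = z * (u - v) ^+ k.
  have := congr1 (fun x => x ^+ q) Ez'.
  rewrite /= exprMn ![(_ ^+ k) ^+ q]exprAC !frobB !frobK => ->.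
  by rewrite mulrA (mulrC z) zq mul1r.
have chi : (u - v) ^+ m = - ii.
  apply: (mulIf (_ : (u - v) ^+ k != 0)).
    by rewrite expf_neq0 // subr_eq0.
  rewrite chi_mul frobB Ez -(opprB v) (exprNn (v - _)) sgn mul1r Econj.
  by rewrite -z_sq; ring.
rewrite chi negb_or i3 andbT.
by apply: contraNneq i1 => <-; rewrite addNr.
Qed.

End HalfNeighborhoods.

(** * The subfield as a set of Frobenius fixed points, and [S] through the quartic character *)

Lemma subfield_fixP {F : finFieldType} {q : nat} {K : {set F}} :
  GRing.divring_closed (mem K) -> #|K| = q -> (1 < q)%N ->
  forall x, (x \in K) = (x ^+ q == x).
Proof.
move=> [K1 KB KV] K_card q_gt1.
have K0 : 0 \in K by rewrite -(subrr 1) KB.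
have KM x y : x \in K -> y \in K -> x * y \in K.
  by move=> xK yK; rewrite -[y]invrK KV // -div1r KV.
have K_fix x : x \in K -> x ^+ q = x.
  have [->|x0 xK] := eqVneq x 0; first by rewrite expr0n gtn_eqF // ltnW.
  have prod0 : \prod_(y in K :\ 0) y != 0.
    by apply/prodf_neq0 => y; rewrite !inE => /andP[].
  have cardK0 : #|K :\ 0| = q.-1.
    by move: (cardsD1 0 K); rewrite K0 K_card => ->.
  (* Multiplication by [x] permutes the nonzero elements of [K], so it preserves their product. *)
  have xq1 : x ^+ q.-1 = 1.
    apply: (mulIf prod0); rewrite mul1r -cardK0 -prodr_const -big_split /=.
    rewrite [RHS](reindex_onto (fun y => x * y) (fun y => x^-1 * y)) /=.
      apply: eq_bigl => y; rewrite !inE mulKf // eqxx andbT.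
      rewrite mulf_eq0 (negPf x0) /=; congr (_ && _).
      apply/idP/idP => yK; first exact: KM.
      by rewrite -(mulKf x0 y) mulrC KV.
    by move=> y _; rewrite mulVKf.
  by rewrite -(prednK (ltnW q_gt1)) exprS xq1 mulr1.
move=> x; apply/idP/eqP => [/K_fix//|xq].
pose h : {poly F} := 'X^q - 'X.
have szh : size h = q.+1.
  by rewrite size_polyDl ?size_polyXn // size_polyN size_polyX.
have h0 : h != 0 by rewrite -size_poly_gt0 szh.
have hroot y : y ^+ q = y -> root h y.
  by move=> yq; rewrite /root hornerD hornerN hornerXn hornerX yq subrr.
(* A fixed point outside [K] would give [X^q - X] at least [q + 1] roots. *)
apply: contraFT (ltnn q.+1) => xK.
have := @max_poly_roots _ h (enum (x |: K)) h0.
rewrite enum_uniq szh -cardE cardsU1 K_card xK; apply => //.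
by apply/allP => y; rewrite mem_enum !inE => /orP[/eqP->|/K_fix]; apply: hroot.
Qed.

(** As [g^m] is a primitive fourth root of unity, [(g^j)^m] determines [j] modulo 4. *)
Lemma peisert_setE {F : finFieldType} {g : F} {m : nat} :
  is_primitive_root g -> (0 < m)%N -> #|F|.-1 = (4 * m)%N ->
  forall y, (y \in peisert_set g) = (y ^+ m == 1) || (y ^+ m == g ^+ m).
Proof.
move=> g_prim m_gt0 F_card y.
have ii_prim : 4.-primitive_root (g ^+ m).
  have := dvdn_prim_root (m := 4) g_prim.
  by rewrite F_card dvdn_mulr // mulKn //; apply.
have dvd4 : (4 %| #|F|.-1)%N by rewrite F_card dvdn_mulr.
have powE j : (g ^+ j) ^+ m = (g ^+ m) ^+ j by rewrite exprAC.
apply/idP/idP => [/(peisert_setP y g_prim dvd4)|ym].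
  case=> j j01 ->; rewrite powE -(expr0 (g ^+ m)) -{4}(expr1 (g ^+ m)).
  by rewrite !(eq_prim_root_expr ii_prim).
have y0 : y != 0.
  apply: contraTneq ym => ->; rewrite expr0n gtn_eqF //= negb_or.
  by rewrite eq_sym oner_eq0 eq_sym (prim_root_eq0 ii_prim).
have /(prim_rootP g_prim)[j yj] : y ^+ #|F|.-1 = 1.
  apply: (mulfI y0); rewrite -exprS prednK ?expf_card ?mulr1 //.
  by apply/card_gt0P; exists 0.
apply/(peisert_setP y g_prim dvd4); exists j => //; move: ym.
rewrite yj powE -(expr0 (g ^+ m)) -{4}(expr1 (g ^+ m)).
by rewrite !(eq_prim_root_expr ii_prim).
Qed.

Lemma primitive_root4_sq {R : idomainType} {z : R} :
  4.-primitive_root z -> z ^+ 2 = -1.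
Proof.
move=> z_prim; apply/eqP; rewrite -addr_eq0.
have : (z ^+ 2 - 1) * (z ^+ 2 + 1) = 0.
  by rewrite -(subrr 1) -[X in _ = X - _](prim_expr_order z_prim); ring.
move/eqP; rewrite mulf_eq0 => /orP[|//]; rewrite subr_eq0 -(expr0 z).
by rewrite (eq_prim_root_expr z_prim).
Qed.

(** * The clique, its size and its maximality *)

Theorem theorem1p6 (p r q : nat) (p_prime : prime p) (r_gt0 : (0 < r)%N)
    (q_def : q = (p ^ r)%N) (q_mod4 : (q %% 4)%N = 3%N) (q_ge7 : (7 <= q)%N)
    (F : finFieldType) (F_card : #|F| = (q ^ 2)%N)
    (g : F) (g_prim : is_primitive_root g)
    (Fq : {set F}) (Fq_subfield : GRing.divring_closed (mem Fq))
    (Fq_card : #|Fq| = q)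
    (u : F) (u_notin : u \notin Fq) :
  maximal_clique (peisert_adj g) (peisert_nbhd g Fq u :|: [set u]) /\
  #|peisert_nbhd g Fq u :|: [set u]| = ((q + 1) %/ 2)%N.
Proof.
pose k := (q.+1 %/ 4)%N; pose m := (q.-1 * k)%N; pose ii := g ^+ m.
have q_k : q.+1 = (4 * k)%N by rewrite /k; lia.
have k_gt1 : (1 < k)%N by lia.
have q_gt1' : (1 < q)%N by lia.
have q_odd : odd q by lia.
have m_gt0 : (0 < m)%N by rewrite muln_gt0; lia.
have pcharF : p \in [pchar F].
  by apply: (@card_finPcharP _ _ (r * 2)) => //; rewrite F_card q_def expnM.
have frob (x y : F) : (x + y) ^+ q = x ^+ q + y ^+ q.
  by apply: exprDn_pchar; rewrite q_def pnatX pnatE // pcharF.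
have q0 : q%:R = 0 :> F by rewrite q_def natrX (pcharf0 pcharF) expr0n gtn_eqF.
(* In [F], [4k = q + 1 = 1], so [k] and 2 are invertible. *)
have k4 : 4%:R * k%:R = 1 :> F by rewrite -natrM -q_k -addn1 natrD q0 add0r.
have k_neq0 : k%:R != 0 :> F.
  by apply: contraTneq (oner_neq0 F) => k0; rewrite -k4 k0 mulr0 eqxx.
have two_neq0 : 2%:R != 0 :> F.
  apply: contraTneq (oner_neq0 F) => two0.
  by rewrite -k4 (natrM _ 2 2) two0 !mul0r eqxx.
have card_pred : #|F|.-1 = (4 * m)%N by rewrite F_card /m mulnCA -q_k; nia.
have ii_sq : ii ^+ 2 = -1.
  apply: primitive_root4_sq; have := dvdn_prim_root (m := 4) g_prim.
  by rewrite card_pred dvdn_mulr // mulKn //; apply.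
have S_E := peisert_setE g_prim m_gt0 card_pred.
have K_fix := subfield_fixP Fq_subfield Fq_card q_gt1'.
have nbhdE v : peisert_nbhd g Fq v = @quartic_nbhd F q k ii Fq v.
  by apply/setP => x; rewrite !inE /peisert_adj S_E.
have k_gt0 := ltnW k_gt1.
(* The exponent [m] is even because [q] is odd. *)
have adj_sym x y : peisert_adj g x y = peisert_adj g y x.
  rewrite /peisert_adj !S_E -(opprB y x) exprNn /m exprM.
  by rewrite -signr_odd (_ : odd q.-1 = false) ?expr1n ?mul1r //; lia.
(* A nonzero [y] in [Fq] has [y^(q-1) = 1], hence [y^m = 1]. *)
have adjK x y : x \in Fq -> y \in Fq -> x != y -> peisert_adj g x y.
  rewrite !K_fix => /eqP xq /eqP yq xy.
  have xy0 : x - y != 0 by rewrite subr_eq0.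
  rewrite /peisert_adj S_E /m exprM (_ : (x - y) ^+ q.-1 = 1) ?expr1n ?eqxx //.
  apply: (mulfI xy0); rewrite mulr1 -exprS prednK ?(ltnW q_gt1') //.
  by rewrite (frobB frob k_gt0 q_k) xq yq.
have card_nbhd v : v \notin Fq -> #|peisert_nbhd g Fq v| = (k + k).-1.
  by move=> vK; rewrite nbhdE (card_quartic_nbhd frob _ q_k).
have u_nbhd : u \notin peisert_nbhd g Fq u by rewrite inE (negPf u_notin).
split; last first.
  by rewrite setUC cardsU1 u_nbhd card_nbhd //; lia.
apply/andP; split.
  apply/forall_inP => x xA; apply/forall_inP => y yA; apply/implyP => xy.
  move: xA yA xy; rewrite !inE.
  move=> /orP[/andP[xK ux]|/eqP->] /orP[/andP[yK uy]|/eqP->].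
  - exact: adjK.
  - by rewrite adj_sym.
  - by [].
  - by rewrite eqxx.
apply/forallP => v; apply/implyP; rewrite !inE negb_or => /andP[vA vu].
apply/negP => /forall_inP/(_ v (setU11 _ _))/forall_inP v_adj.
have adj_vu : peisert_adj g v u.
  by have := v_adj u; rewrite !inE eqxx !orbT vu; apply.
have [vK|vK] := boolP (v \in Fq).
  by move: vA; rewrite vK adj_sym adj_vu.
(* Adjacency of [v] to all of [N(u)] gives one inclusion; equal cardinalities give the other. *)
have uv_nbhd : peisert_nbhd g Fq u = peisert_nbhd g Fq v.
  apply/eqP; rewrite eqEcard !card_nbhd // leqnn andbT.
  apply/subsetP => x; rewrite inE => /andP[xK ux]; rewrite inE xK.
  have vx : v != x by apply: contraNneq vK => ->.
  by have := v_adj x; rewrite !inE xK ux orbT vx; apply.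
have uv : u != v by rewrite eq_sym.
rewrite !nbhdE in uv_nbhd.
have := eq_quartic_nbhd_not_adj frob k_gt0 q_k F_card ii_sq two_neq0 K_fix
  Fq_card k_gt1 k_neq0 u_notin vK uv uv_nbhd.
by move: adj_vu; rewrite adj_sym /peisert_adj S_E => ->.
Qed.
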